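(* Let $\gamma=\{x\in\mathbb{R}^2:F(x)=0\}$ be a smooth compact curve and let $T=\triangle o_0o_1o_2$ be a triangle consistent with $\gamma$. Case 1. If $\operatorname{sgn}F(o_0)=\operatorname{sgn}F(o_1)=\operatorname{sgn}F(o_2)$, then $\gamma\cap T=\emptyset$. Case 2. If $-\operatorname{sgn}F(o_0)=\operatorname{sgn}F(o_1)=\operatorname{sgn}F(o_2)$, then the map $$\varphi:T\cap\gamma\to\overline{o_1o_2},$$ sending $p$ to the intersection of the ray from $o_0$ through $p$ with the segment $\overline{o_1o_2}$, is bijective.
   Context: $\gamma$ is a compact regular level set of a smooth function $F$, i.e. $\nabla F\neq 0$ on $\gamma$. The reach $r_\gamma$ is the supremum of all $r>0$ such that every $x$ with $\operatorname{dist}(x,\gamma)<r$ has a unique closest point on $\gamma$. $K_\gamma=\max_{x\in\gamma}|\kappa(x)|$, with $\kappa$ the curvature. With $h_T=\operatorname{diam}(T)$, the triangle $T=\triangle o_0o_1o_2$ is consistent with $\gamma$ if, for a constant $c_0>0$ independent of $h_T$, $h_T<r_\gamma$, $h_TK_\gamma\le\frac14$, and $\operatorname{dist}(o_i,\gamma)>\max\{c_0h_T,K_\gamma h_T^2\}$ for $i=0,1,2$. *)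

(* Defs.v *)
From HB Require Import structures.
From mathcomp Require Import all_boot all_order all_algebra.
From mathcomp Require Import all_classical all_reals all_analysis.

Set Implicit Arguments.
Unset Strict Implicit.
Unset Printing Implicit Defensive.

Import Order.TTheory GRing.Theory Num.Theory.
Import numFieldNormedType.Exports.

Local Open Scope classical_set_scope.
Local Open Scope ring_scope.

Section EuclideanPlane.
Variable R : realType.
Implicit Types (x p q : 'rV[R]_2) (A : set 'rV[R]_2).

(* The library norm on 'rV[R]_2 is the sup norm. It induces the usual topology
   and the usual notion of derivative, but not the Euclidean distance. *)
Definition enorm x : R := Num.sqrt (\sum_(i < 2) x 0 i ^+ 2).

Definition dist x A : R := inf [set enorm (x - y) | y in A].

Definition diam A : R := sup [set enorm (p.1 - p.2) | p in A `*` A].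

Definition closest_point A x p : Prop := A p /\ enorm (x - p) = dist x A.

Definition reach A : \bar R :=
  ereal_sup [set r%:E | r in [set r : R | 0 < r /\
    forall x, dist x A < r -> exists! p, closest_point A x p]].

Definition segment p q : set 'rV[R]_2 :=
  [set x | exists t : R, [/\ 0 <= t, t <= 1 & x = (1 - t) *: p + t *: q]].

Definition ray o p : set 'rV[R]_2 :=
  [set x | exists t : R, 0 <= t /\ x = o + t *: (p - o)].

Definition triangle o0 o1 o2 : set 'rV[R]_2 :=
  [set x | exists a b c : R, [/\ 0 <= a, 0 <= b, 0 <= c, a + b + c = 1
    & x = a *: o0 + b *: o1 + c *: o2]].

Definition triangle_nondegenerate (o0 o1 o2 : 'rV[R]_2) : Prop :=
  free [:: o1 - o0; o2 - o0].

End EuclideanPlane.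

Section LevelCurve.
Variable R : realType.
Implicit Types (F : 'rV[R]_2 -> R) (x : 'rV[R]_2).

Definition partial (i : 'I_2) F : 'rV[R]_2 -> R :=
  fun x => 'D_(delta_mx 0 i) F x.

(* Infinite differentiability: the partial derivatives of every order (the
   empty list gives F itself) exist and are Frechet differentiable, hence
   continuous. *)
Definition smooth F : Prop :=
  forall (s : seq 'I_2) x, differentiable (foldr partial F s) x.

Definition grad F x : 'rV[R]_2 := \row_(i < 2) partial i F x.

Definition zero_set F : set 'rV[R]_2 := [set x | F x = 0].

Definition unit_normal F x : 'rV[R]_2 := (enorm (grad F x))^-1 *: grad F x.

(* Signed curvature at x of the level curve of F through x, as the divergence
   of the unit normal field grad F / |grad F|; equivalently
   (F_xx F_y^2 - 2 F_xy F_x F_y + F_yy F_x^2) / |grad F|^3.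
   Its absolute value does not depend on the choice of F. *)
Definition curvature F x : R :=
  \sum_(i < 2) partial i (fun y => unit_normal F y 0 i) x.

(* For a compact regular zero set of a smooth F the supremum is a maximum. *)
Definition max_curvature F : R :=
  sup [set `|curvature F x| | x in zero_set F].

Definition consistent F (c0 : R) (o0 o1 o2 : 'rV[R]_2) : Prop :=
  let h := diam (triangle o0 o1 o2) in
  let K := max_curvature F in
  [/\ (h%:E < reach (zero_set F))%E,
      h * K <= 4^-1
    & forall o, o \in [:: o0; o1; o2] ->
        Num.max (c0 * h) (K * h ^+ 2) < dist o (zero_set F)].

End LevelCurve.

(* Main.v *)
Require Import Defs.
From mathcomp Require Import all_boot all_order all_algebra.
From mathcomp Require Import all_classical all_reals all_analysis.
From mathcomp Require Import ring lra.

Set Implicit Arguments.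
Unset Strict Implicit.
Unset Printing Implicit Defensive.

Import Order.TTheory GRing.Theory Num.Theory.
Import numFieldNormedType.Exports.

Local Open Scope classical_set_scope.
Local Open Scope ring_scope.

(** Everything follows from one fact about a zero [p] of [F] in the triangle and
    a vertex [o] ([far_point_side], [vertex_side]): the sign of [F o] is the sign
    of [dot (o - p) (grad F p)]. The vertices where [F] is positive lie strictly
    on one side of the tangent line at [p], those where it is negative strictly
    on the other side.

    In the first case all three vertices would lie strictly on one side of a line
    through the point [p] of the triangle, which is absurd. In the second case
    [o0] and the edge [o1 o2] lie on opposite sides of the tangent line at every
    zero [p]. So [F] has no zero on the edge, it changes sign along each segment
    from [o0] to the edge, and at each zero on this segment it increases (or, for
    the opposite signs, decreases); it therefore vanishes exactly once there
    ([central_projection_bij]).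

    The fact itself is a second-order Taylor estimate for the signed distance to
    the curve along the segment from [p] to [o], whose length is at most the
    diameter [h] of the triangle. As [h] is less than the reach, every point [x]
    of the segment has a unique closest point [foot x] on the curve, and
    compactness makes it depend continuously on [x]
    ([closest_point_continuous]). A ball around [x] that touches the curve at
    [foot x] contains no zero of [F], which forces [x - foot x] to be normal to
    the curve ([closest_unit_normal_pos]). The curvature bounds the rate at which
    the unit normal turns as a point moves on the curve ([normal_turning]), so by
    [h * K <= 1/4] the foot moves at most [10/7] times as fast as [x]
    ([foot_displacement]). Hence the signed distance has the unit normal at the
    foot as gradient, and along a unit segment this gradient varies at rate at
    most about [10/7 * K] ([foot_variation]). If the derivative at [p] towards
    [o] were not positive, the signed distance of [o] could not exceed
    [5/7 * K * h ^ 2] up to an arbitrarily small error, while consistency requires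
    more than [K * h ^ 2].

    No parametrisation of the curve enters: the curve is followed through the
    feet of the points of a segment, and the derivative estimates are pointwise
    bounds, integrated by real induction ([right_nonincr]). *)

(** * The Euclidean plane *)

Section Plane.
Context {R : realType}.
Implicit Types (u v w x y n : 'rV[R]_2) (c : R).

Definition dot u v : R := \sum_(i < 2) u 0 i * v 0 i.

Lemma dotE u v : dot u v = u 0 0 * v 0 0 + u 0 1 * v 0 1.
Proof.
by rewrite /dot !big_ord_recl big_ord0 addr0;
  congr (_ + u 0 _ * v 0 _); exact: val_inj.
Qed.

Lemma row2P u v : u 0 0 = v 0 0 -> u 0 1 = v 0 1 -> u = v.
Proof.
move=> e0 e1; apply/rowP => i.
by case: i => [[|[|//]] lti]; [move: e0 | move: e1]; congr (_ = _);
  congr (_ 0 _); exact: val_inj.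
Qed.

Lemma sub_split x y u v m n c d : x - u = c *: m -> y - v = d *: n ->
  x - y = u - v + c *: (m - n) + (c - d) *: n.
Proof.
move=> xu yv; rewrite -addrA scalerBr scalerBl subrKA -xu -yv.
by apply/rowP => i; rewrite !mxE; ring.
Qed.

Lemma dotC u v : dot u v = dot v u.
Proof. by rewrite !dotE; ring. Qed.

Lemma dotDl u v w : dot (u + v) w = dot u w + dot v w.
Proof. by rewrite !dotE !mxE; ring. Qed.

Lemma dotZl c u v : dot (c *: u) v = c * dot u v.
Proof. by rewrite !dotE !mxE; ring. Qed.

Lemma dotNl u v : dot (- u) v = - dot u v.
Proof. by rewrite !dotE !mxE; ring. Qed.

Lemma dotBl u v w : dot (u - v) w = dot u w - dot v w.
Proof. by rewrite dotDl dotNl. Qed.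

Lemma dotDr u v w : dot w (u + v) = dot w u + dot w v.
Proof. by rewrite dotC dotDl !(dotC w). Qed.

Lemma dotZr c u v : dot v (c *: u) = c * dot v u.
Proof. by rewrite dotC dotZl dotC. Qed.

Lemma dotNr u v : dot v (- u) = - dot v u.
Proof. by rewrite dotC dotNl dotC. Qed.

Lemma dotBr u v w : dot w (u - v) = dot w u - dot w v.
Proof. by rewrite dotDr dotNr. Qed.

Lemma dot_ge0 u : 0 <= dot u u.
Proof. by rewrite dotE; nra. Qed.

Lemma dot_eq0 u : (dot u u == 0) = (u == 0).
Proof.
apply/eqP/eqP => [|->]; last by rewrite dotE !mxE; ring.
rewrite dotE => u0; apply: row2P; rewrite mxE; nra.
Qed.

Lemma enormE u : enorm u = Num.sqrt (dot u u).
Proof. by []. Qed.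

Lemma enorm_ge0 u : 0 <= enorm u.
Proof. exact: sqrtr_ge0. Qed.

Lemma enorm_sqr u : enorm u ^+ 2 = dot u u.
Proof. by rewrite enormE sqr_sqrtr ?dot_ge0. Qed.

Lemma enorm_eq0 u : (enorm u == 0) = (u == 0).
Proof. by rewrite -sqrf_eq0 enorm_sqr dot_eq0. Qed.

Lemma enorm_gt0 u : (0 < enorm u) = (u != 0).
Proof. by rewrite lt0r enorm_eq0 enorm_ge0 andbT. Qed.

Lemma enorm0 : enorm (0 : 'rV[R]_2) = 0.
Proof. by apply/eqP; rewrite enorm_eq0. Qed.

Lemma enormN u : enorm (- u) = enorm u.
Proof. by rewrite !enormE dotNl dotNr opprK. Qed.

Lemma enormB u v : enorm (u - v) = enorm (v - u).
Proof. by rewrite -enormN opprB. Qed.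

Lemma enormZ c u : enorm (c *: u) = `|c| * enorm u.
Proof.
by rewrite !enormE dotZl dotZr mulrA -expr2 sqrtrM ?sqr_ge0// sqrtr_sqr.
Qed.

Lemma dot_le_enorm u v : `|dot u v| <= enorm u * enorm v.
Proof.
rewrite -(@ler_pXn2r _ 2%N) ?nnegrE ?mulr_ge0 ?enorm_ge0//.
rewrite exprMn !enorm_sqr real_normK ?num_real// !dotE.
have := sqr_ge0 (u 0 0 * v 0 1 - u 0 1 * v 0 0); nra.
Qed.

Lemma ler_enormD u v : enorm (u + v) <= enorm u + enorm v.
Proof.
rewrite -(@ler_pXn2r _ 2%N) ?nnegrE ?addr_ge0 ?enorm_ge0//.
rewrite enorm_sqr sqrrD !enorm_sqr dotDl !dotDr (dotC v u).
by have := dot_le_enorm u v; rewrite ler_norml => /andP[_]; lra.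
Qed.

Lemma ler_enormB3 u v w : enorm (u - w) <= enorm (u - v) + enorm (v - w).
Proof. by rewrite (le_trans _ (ler_enormD _ _))// subrKA. Qed.

(** For a unit vector [n] the pair [n], [perp n] is an orthonormal frame. *)
Definition perp n : 'rV[R]_2 := \row_i (if i == 0 then - n 0 1 else n 0 0).

Lemma perp0 n : perp n 0 0 = - n 0 1. Proof. by rewrite mxE. Qed.
Lemma perp1 n : perp n 0 1 = n 0 0. Proof. by rewrite mxE. Qed.

Lemma dot_perp n : dot n (perp n) = 0.
Proof. by rewrite dotE perp0 perp1; ring. Qed.

Lemma dot_perp_eq0 u v : dot v (perp u) = 0 -> dot u u *: v = dot v u *: u.
Proof.
rewrite !dotE perp0 perp1 => uv.
by apply: row2P; rewrite !mxE; move/(congr1 ( *%R (- u 0 1))): (uv);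
  move/(congr1 ( *%R (u 0 0))): uv; lra.
Qed.

Lemma enorm_perp n : enorm (perp n) = enorm n.
Proof. by rewrite !enormE !dotE perp0 perp1; congr Num.sqrt; ring. Qed.

Lemma dot_frame n u v : dot n n = 1 ->
  dot u v = dot u n * dot v n + dot u (perp n) * dot v (perp n).
Proof.
move=> n1; rewrite -[LHS]mul1r -n1 !dotE perp0 perp1; ring.
Qed.

Lemma frame_decomp n u : dot n n = 1 ->
  u = dot u n *: n + dot u (perp n) *: perp n.
Proof.
rewrite !dotE perp0 perp1 => n1; apply: row2P; rewrite !mxE /=.
  by rewrite -[LHS]mul1r -n1; ring.
by rewrite -[LHS]mul1r -n1; ring.
Qed.

Lemma enorm_le_coords u : enorm u <= `|u 0 0| + `|u 0 1|.
Proof.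
rewrite -(@ler_pXn2r _ 2%N) ?nnegrE ?addr_ge0 ?enorm_ge0//.
rewrite enorm_sqr dotE sqrrD !real_normK ?num_real//.
have : 0 <= `|u 0 0| * `|u 0 1| by rewrite mulr_ge0.
lra.
Qed.

Lemma enorm_le_frame n u : dot n n = 1 ->
  enorm u <= `|dot u n| + `|dot u (perp n)|.
Proof.
move=> n1; rewrite -(@ler_pXn2r _ 2%N) ?nnegrE ?addr_ge0 ?enorm_ge0//.
rewrite enorm_sqr (dot_frame u u n1) sqrrD !real_normK ?num_real//.
have : 0 <= `|dot u n| * `|dot u (perp n)| by rewrite mulr_ge0.
lra.
Qed.

Lemma norm_le_enorm u : `|u| <= enorm u.
Proof.
rewrite /Num.norm/= mx_normrE; apply: bigmax_le => [|[i j] _ /=].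
  exact: enorm_ge0.
rewrite (ord1 i) -(@ler_pXn2r _ 2%N) ?nnegrE ?enorm_ge0//.
rewrite enorm_sqr real_normK ?num_real// /dot (bigD1 j)//= -expr2 lerDl.
by apply: sumr_ge0 => k _; rewrite -expr2 sqr_ge0.
Qed.

Lemma coord_le_norm u i : `|u 0 i| <= `|u|.
Proof.
rewrite [leRHS]/Num.norm/= mx_normrE.
by rewrite (le_bigmax _ (fun i : 'I_1 * 'I_2 => `|u i.1 i.2|) (0, i)).
Qed.

Lemma enorm_le_norm u : enorm u <= 2 * `|u|.
Proof.
rewrite -(@ler_pXn2r _ 2%N) ?nnegrE ?mulr_ge0 ?enorm_ge0//.
rewrite enorm_sqr dotE -!expr2 -(real_normK (num_real (u 0 0))).
rewrite -(real_normK (num_real (u 0 1))).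
have := coord_le_norm u 0; have := coord_le_norm u 1.
have := normr_ge0 (u 0 0); have := normr_ge0 (u 0 1); nra.
Qed.

(** The topology of the plane comes from the sup norm, whereas all distances
    below are Euclidean. *)
Lemma enorm_nbhsP x (U : set 'rV[R]_2) :
  nbhs x U <-> exists2 e, 0 < e & forall y, enorm (y - x) < e -> U y.
Proof.
split=> [/nbhs_ballP[e /= e0 eU]|[e e0 eU]].
  exists e => // y yx; apply: eU.
  by rewrite -ball_normE /= distrC (le_lt_trans (norm_le_enorm _)).
apply/nbhs_ballP; exists (e / 2) => /=; first by rewrite divr_gt0.
move=> y; rewrite -ball_normE /= distrC => yx; apply: eU.
rewrite (le_lt_trans (enorm_le_norm _))//; lra.
Qed.

Lemma enorm_continuous : continuous (@enorm R).
Proof.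
move=> x; apply/(@cvgrPdist_lt _ _ _ (nbhs x) (nbhs_filter x)) => e e0.
apply/enorm_nbhsP; exists e => // y yx.
rewrite (le_lt_trans _ yx)// ler_norml.
have := ler_enormD (x - y) y; have := ler_enormD (y - x) x.
by rewrite !subrK enormB; lra.
Qed.

End Plane.
(** * Real induction *)

Section RealInduction.
Context {R : realType}.
Implicit Types (a b t : R) (f : R -> R).

(** The supremum of the points up to which [P] holds has the property by the
    last hypothesis, and cannot be less than [b] by the one before. *)
Lemma real_induction a b (P : R -> Prop) : a <= b -> P a ->
  (forall t, a <= t < b -> P t ->
     exists2 d, 0 < d & forall s, t < s < t + d -> P s) ->
  (forall t, a < t <= b -> (forall s, a <= s < t -> P s) -> P t) ->
  forall t, a <= t <= b -> P t.
Proof.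
move=> ab Pa Pright Pleft.
pose S := [set t | a <= t <= b /\ forall s, a <= s <= t -> P s].
have Sa : S a.
  by split=> [|s]; rewrite ?lexx ?ab// -eq_le => /eqP <-.
have ubS : ubound S b by move=> t [/andP[]].
have supS : has_sup S by split; [exists a | exists b].
have aS : a <= sup S by apply: ub_le_sup => //; exists b.
have Sb : sup S <= b by apply: ge_sup => //; exists a.
have belowP s : a <= s < sup S -> P s.
  case/andP=> as_ /(sup_gt (ex_intro _ a Sa)) [t [_ Pt] st].
  by apply: Pt; rewrite as_ ltW.
have PS : P (sup S).
  have [eqa|nea] := eqVneq (sup S) a; first by rewrite eqa.
  by apply: Pleft => //; rewrite lt_neqAle eq_sym nea aS.
have uptoP s : a <= s <= sup S -> P s.
  case/andP=> as_; rewrite le_eqVlt => /predU1P[->//|sS].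
  by apply: belowP; rewrite as_.
suff <- : sup S = b by [].
apply/eqP; rewrite eq_le Sb /= leNgt; apply/negP => Sltb.
have [|d d0 Pd] := Pright (sup S) _ PS; first by rewrite aS.
pose t := Num.min b (sup S + d / 2).
have tS : sup S < t by rewrite lt_min Sltb /= ltrDl divr_gt0.
suff St : S t by have := ub_le_sup (ex_intro _ b ubS) St; rewrite leNgt tS.
split; first by rewrite ge_min lexx /= andbT (le_trans aS)// ltW.
move=> s /andP[as_ st]; have [sS|Ss] := leP s (sup S).
  by apply: uptoP; rewrite as_.
apply: Pd; rewrite Ss /= (le_lt_trans st)//.
by rewrite gt_min; apply/orP; right; lra.
Qed.

Lemma continuous_eps f t e : {for t, continuous f} -> 0 < e ->
  exists2 d, 0 < d & forall s, `|s - t| < d -> `|f s - f t| < e.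
Proof.
move=> /cvgrPdist_lt fc /fc /nbhs_ballP[d /= d0 fd]; exists d => // s st.
by rewrite distrC; apply: fd; rewrite /ball/= distrC.
Qed.

Lemma lipschitz_at_continuous f t M d : 0 < d ->
  (forall s, `|s - t| < d -> `|f s - f t| <= M * `|s - t|) ->
  {for t, continuous f}.
Proof.
move=> d0 fM; apply/cvgrPdist_lt => e e0; apply/nbhs_ballP.
pose M' := `|M| + 1; have M'0 : 0 < M' by rewrite ltr_wpDl.
exists (Num.min d (e / M')) => /=; first by rewrite lt_min d0 divr_gt0.
move=> s; rewrite /ball/= distrC lt_min => /andP[/fM sM].
rewrite ltr_pdivlMr// => sM'; rewrite distrC (le_lt_trans sM)//.
rewrite (le_lt_trans _ sM')// mulrC ler_wpM2l//.
by rewrite (le_trans (ler_norm M))// lerDl.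
Qed.

(** Takes the place of the mean value theorem where only local one-sided bounds
    on the increments of [f] are known. *)
Lemma right_nonincr a b f : a <= b ->
  (forall t, a <= t <= b -> {for t, continuous f}) ->
  (forall t, a <= t < b ->
     exists2 d, 0 < d & forall s, t < s < t + d -> f s <= f t) ->
  f b <= f a.
Proof.
move=> ab fc fr.
apply: (@real_induction a b (fun t => f t <= f a)) => //; last by rewrite ab/=.
  move=> t /fr[d d0 fd] fta; exists d => // s /fd /le_trans; exact.
move=> t /andP[at_ tb] IH; rewrite leNgt; apply/negP => fat.
have [||d d0 fd] := @continuous_eps f t (f t - f a) (fc t _).
- by rewrite ltW.
- by rewrite subr_gt0.
pose s := Num.max a (t - d / 2).
have st : s < t by rewrite gt_max at_ /= ltrBlDr ltrDl divr_gt0.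
have as_ : a <= s by rewrite le_max lexx.
have ts : t - d / 2 <= s by rewrite le_max lexx orbT.
have /fd : `|s - t| < d by rewrite ltr_norml; lra.
have := IH s; rewrite as_ st => /(_ isT) fs.
rewrite ltr_norml; lra.
Qed.

(** After a first zero [f] stays non-negative, because it increases through every
    zero; so it cannot reach a further zero from below. *)
Lemma increasing_zero_uniq a b f : a <= b ->
  (forall t, a <= t <= b -> {for t, continuous f}) ->
  (forall t, a <= t <= b -> f t = 0 -> exists2 d, 0 < d &
     (forall s, t < s < t + d -> 0 < f s) /\
     (forall s, t - d < s < t -> f s < 0)) ->
  f a = 0 -> f b = 0 -> a = b.
Proof.
move=> ab fc fz fa fb; apply/eqP; rewrite eq_le ab leNgt; apply/negP => altb.
have f_ge0 t : a <= t <= b -> 0 <= f t.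
  apply: (@real_induction a b (fun t => 0 <= f t)) => //; first by rewrite fa.
    move=> {}t /andP[at_ tb]; rewrite le0r => /predU1P[ft0|ft0].
      have [|d d0 [fd _]] := fz t _ ft0; first by rewrite at_ ltW.
      by exists d => // s /fd /ltW.
    have [|d d0 fd] := @continuous_eps f t (f t) (fc t _) ft0.
      by rewrite at_ ltW.
    exists d => // s ts; have /fd : `|s - t| < d by rewrite ltr_norml; lra.
    by rewrite ltr_norml; lra.
  move=> {}t /andP[at_ tb] IH; rewrite leNgt; apply/negP => ft0.
  have [||d d0 fd] := @continuous_eps f t (- f t) (fc t _).
  - by rewrite ltW.
  - by rewrite oppr_gt0.
  pose s := Num.max a (t - d / 2).
  have st : s < t by rewrite gt_max at_ /= ltrBlDr ltrDl divr_gt0.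
  have as_ : a <= s by rewrite le_max lexx.
  have ts : t - d / 2 <= s by rewrite le_max lexx orbT.
  have /fd : `|s - t| < d by rewrite ltr_norml; lra.
  have := IH s; rewrite as_ st => /(_ isT) fs.
  rewrite ltr_norml; lra.
have [|d d0 [_ fd]] := fz b _ fb; first by rewrite lexx ab.
pose s := Num.max a (b - d / 2).
have sb : s < b by rewrite gt_max altb /= ltrBlDr ltrDl divr_gt0.
have as_ : a <= s by rewrite le_max lexx.
have bs : b - d / 2 <= s by rewrite le_max lexx orbT.
have := f_ge0 s; rewrite as_ ltW// => /(_ isT).
by rewrite leNgt fd//; lra.
Qed.

End RealInduction.

(** * Closest points *)

Section ClosestPoint.
Context {R : realType}.
Implicit Types (x y p q : 'rV[R]_2) (A : set 'rV[R]_2).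

Lemma dist_le x y A : A y -> dist x A <= enorm (x - y).
Proof.
move=> Ay; apply: ge_inf; last by exists y.
by exists 0 => _ [z _ <-]; exact: enorm_ge0.
Qed.

Lemma dist_ge0 x A : 0 <= dist x A.
Proof.
have [[y Ay]|/set0P/negP/negPn/eqP->] := pselect (A !=set0).
  apply: lb_le_inf => [|_ [z _ <-]]; first by exists (enorm (x - y)), y.
  exact: enorm_ge0.
by rewrite /dist image_set0 inf0.
Qed.

Lemma closest_self x q A : A x -> closest_point A x q -> q = x.
Proof.
move=> Ax [Aq]; have := dist_le x Ax; rewrite subrr enorm0 => d0 xq.
by apply/esym/eqP; rewrite -subr_eq0 -enorm_eq0 eq_le enorm_ge0 xq d0.
Qed.

(** The points of the compact [A] away from [q0] stay farther from [x0] than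
    [q0] does, by a margin that survives moving [x0] a little. *)
Lemma closest_point_continuous A x0 q0 (U : set 'rV[R]_2) : compact A ->
  closest_point A x0 q0 -> (forall q, closest_point A x0 q -> q = q0) ->
  nbhs q0 U ->
  exists2 e, 0 < e &
    forall x q, enorm (x - x0) < e -> closest_point A x q -> U q.
Proof.
move=> cA [Aq0 xq0] q0uniq nU; pose B := A `&` ~` U^°.
have cB : compact B.
  by apply: compact_closedI => //; apply: open_closedC; exact: open_interior.
have [B0|nB] := pselect (B !=set0); last first.
  exists 1 => // x q _ [Aq _]; apply: contrapT => nUq; apply: nB.
  by exists q; split => // /interior_subset.
have fc : continuous (fun y => enorm (x0 - y)).
  move=> y; apply: continuous_comp; last exact: enorm_continuous.
  have fy := nbhs_filter y.
  apply: (@cvgB _ _ _ (nbhs y) _ (cst x0) id); first exact: cvg_cst.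
  exact: cvg_id.
have [c] := EVT_min_rV B0 cB (continuous_subspaceT fc).
rewrite inE => -[Ac nUc] cmin.
have x0c : enorm (x0 - q0) < enorm (x0 - c).
  rewrite lt_neqAle xq0 dist_le// andbT; apply/eqP => e; apply: nUc.
  by rewrite (q0uniq c)//; split.
exists ((enorm (x0 - c) - enorm (x0 - q0)) / 2).
  by rewrite divr_gt0// subr_gt0.
move=> x q xx0 [Aq xq]; apply: contrapT => nUq.
have /cmin : q \in B by rewrite inE; split => // /interior_subset.
have := dist_le x Aq0; rewrite -xq.
have := ler_enormB3 x x0 q0; have := ler_enormB3 x0 x q.
rewrite (enormB x0 x); lra.
Qed.

End ClosestPoint.
(** * Gradients and normals *)

Section Gradient.
Context {R : realType}.
Implicit Types (f F : 'rV[R]_2 -> R) (x y v w p q : 'rV[R]_2).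

Lemma derive_grad f x v : differentiable f x -> 'D_v f x = dot (grad f x) v.
Proof.
move=> df; rewrite deriveE// [in LHS](row_sum_delta v) linear_sum /dot.
by apply: eq_bigr => i _; rewrite linearZ/= mxE /partial deriveE// mulrC.
Qed.

Lemma grad_approx f x e : differentiable f x -> 0 < e ->
  exists2 d, 0 < d & forall y, enorm (y - x) < d ->
    `|f y - f x - dot (grad f x) (y - x)| <= e * enorm (y - x).
Proof.
move=> df e0.
have /enorm_nbhsP[d d0 fd] : nbhs (0 : 'rV[R]_2)
    [set y | `|f (y + x) - f x - 'd f x y| <= e * `|y|].
  have /eqaddoP/(_ _ e0) := diff_locally df.
  by apply: filterS => y /=; rewrite opprD addrA.
exists d => // y yx; have /= := fd (y - x).
rewrite subr0 subrK => /(_ yx) /le_trans; rewrite -derive_grad// deriveE//.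
by apply; rewrite ler_pM2l// norm_le_enorm.
Qed.
Lemma increase_along f x v : differentiable f x -> 0 < dot (grad f x) v ->
  exists2 d, 0 < d & forall t, 0 < t < d ->
    f x < f (x + t *: v) /\ f (x - t *: v) < f x.
Proof.
set D := dot _ _ => df D0; pose M := enorm v + 1.
have M0 : 0 < M by rewrite ltr_wpDl ?enorm_ge0.
have MD0 : 0 < D / (2 * M) by rewrite divr_gt0// mulr_gt0.
have [d d0 fd] := grad_approx df MD0.
exists (d / M) => [|t /andP[t0 td]]; first by rewrite divr_gt0.
have tMd : t * M < d by rewrite -ltr_pdivlMr.
have tv : t * enorm v < d by rewrite (le_lt_trans _ tMd)// ler_pM2l// lerDl.
have small : D / (2 * M) * (t * enorm v) <= t * D / 2.
  have -> : t * D / 2 = D / (2 * M) * (t * M) by field; rewrite gt_eqF.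
  by rewrite ler_pM2l// ler_pM2l// lerDl.
have tD : 0 < t * D by rewrite mulr_gt0.
have := fd (x + t *: v); have := fd (x - t *: v).
rewrite ![x + _]addrC !addrK enormN dotNr enormZ gtr0_norm// dotZr -/D.
move=> /(_ tv); rewrite ler_norml => /andP[_ fm].
move=> /(_ tv); rewrite ler_norml => /andP[fp _].
split; lra.
Qed.

Lemma line_continuous x v : continuous (fun t : R => x + t *: v).
Proof.
move=> t; apply: cvgD; first exact: cvg_cst.
by apply: cvgZr_tmp; exact: cvg_id.
Qed.

Lemma line_comp_continuous f x v : continuous f ->
  continuous (fun t : R => f (x + t *: v)).
Proof.
by move=> fc t; apply: (continuous_comp (@line_continuous x v t)); exact: fc.
Qed.

Lemma segment_zero f x y : continuous f -> f x <= 0 <= f y ->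
  exists2 t, 0 <= t <= 1 & f (x + t *: (y - x)) = 0.
Proof.
move=> fc /andP[fx fy].
have [| |t] := @IVT R (fun t => f (x + t *: (y - x))) 0 1 0 ler01.
- exact/continuous_subspaceT/line_comp_continuous.
- by rewrite scale0r addr0 scale1r subrKC ge_min fx le_max fy orbT.
by rewrite in_itv /= => tI ft; exists t.
Qed.

Lemma dot_unit_normal F x : grad F x != 0 ->
  dot (unit_normal F x) (unit_normal F x) = 1.
Proof.
move=> G0; rewrite dotZl dotZr mulrA -invfM -expr2 enorm_sqr mulVf//.
by rewrite dot_eq0.
Qed.

Lemma gradN F x : differentiable F x -> grad (fun y => - F y) x = - grad F x.
Proof.
move=> dF; apply/rowP => i; rewrite !mxE /partial.
by rewrite -(deriveN (diff_derivable dF)).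
Qed.

Lemma unit_normalN F x : differentiable F x ->
  unit_normal (fun y => - F y) x = - unit_normal F x.
Proof. by move=> dF; rewrite /unit_normal gradN// enormN scalerN. Qed.

Lemma zero_setN F : zero_set (fun y => - F y) = zero_set F.
Proof.
apply/seteqP; split=> x; rewrite /zero_set /=; last by move=> ->; rewrite oppr0.
by move/eqP; rewrite oppr_eq0 => /eqP.
Qed.

(** The ball around [x] touching the curve at [q] contains no zero of [F], so [F]
    is positive in it, hence non-decreasing at [q] in every direction that enters
    the ball; this forces [grad F q] to point to the centre. *)
Lemma closest_unit_normal_pos F x q : continuous F -> differentiable F q ->
  grad F q != 0 -> closest_point (zero_set F) x q -> 0 < F x ->
  x - q = enorm (x - q) *: unit_normal F q.
Proof.
move=> Fc dF G0 [/= Fq xq] Fx; pose u := x - q.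
have Fball y : enorm (y - x) < enorm u -> 0 < F y.
  rewrite ltNge => yx; rewrite ltNge; apply/negP => Fy; case/negP: yx.
  have [|t /andP[t0 t1] Fz] := @segment_zero F y x Fc; first by rewrite Fy ltW.
  rewrite /u xq (le_trans (dist_le _ Fz))//.
  have -> : x - (y + t *: (x - y)) = (1 - t) *: (x - y).
    by rewrite scalerBl scale1r opprD addrA.
  rewrite enormZ enormB ger0_norm ?subr_ge0//.
  by rewrite ler_piMl ?enorm_ge0// lerBlDr lerDl.
have u0 : u != 0.
  rewrite /u subr_eq0; apply/eqP => e; by move: Fx; rewrite e Fq ltxx.
have uu0 : 0 < dot u u by rewrite lt0r dot_eq0 u0 dot_ge0.
have entering v : 0 < dot v u -> 0 <= dot (grad F q) v.
  move=> vu; rewrite leNgt; apply/negP => Gv.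
  have [|d d0 Fd] := @increase_along F q (- v) dF.
    by rewrite dotNr oppr_gt0.
  pose M := dot v v + 1; have M0 : 0 < M by rewrite ltr_wpDl ?dot_ge0.
  pose t := Num.min (d / 2) (dot v u / M).
  have t0 : 0 < t by rewrite lt_min !divr_gt0.
  have td : t < d by rewrite gt_min; apply/orP; left; lra.
  have tM : t * M <= dot v u by rewrite -ler_pdivlMr// ge_min lexx orbT.
  have [|_] := Fd t; first by rewrite t0.
  rewrite scalerN opprK Fq ltNge => /negP[]; apply/ltW/Fball.
  rewrite -(@ltr_pXn2r _ 2%N) ?nnegrE ?enorm_ge0// !enorm_sqr.
  have -> : q + t *: v - x = t *: v - u.
    by rewrite /u opprB addrA; congr (_ - _); exact: addrC.
  rewrite dotBl !(dotBr (t *: v) u) !dotZl !dotZr (dotC u v).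
  have : 0 <= dot v v by exact: dot_ge0.
  have : t * (t * M) <= t * dot v u by rewrite ler_pM2l.
  have : 0 < t * dot v u by rewrite mulr_gt0.
  have : 0 < t * t by rewrite mulr_gt0.
  by rewrite /M; lra.
pose a := dot (grad F q) u; pose b := dot (grad F q) (perp u).
have slope c : 0 <= a + c * b.
  have := entering (u + c *: perp u).
  rewrite dotDl dotZl (dotC (perp u)) dot_perp mulr0 addr0 dotDr dotZr.
  by apply.
have b0 : b = 0.
  apply/eqP; apply: contraT => b0; have := slope (- (a + 1) / b).
  by rewrite divfK//; lra.
have uG : dot u u *: grad F q = a *: u.
  exact: dot_perp_eq0.
have a0 : 0 < a.
  have := slope 0; rewrite mul0r addr0 le0r => /predU1P[a0|//].
  move: uG => /eqP; rewrite a0 scale0r scaler_eq0 (negbTE G0) orbF.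
  by rewrite gt_eqF.
have eG : dot u u * enorm (grad F q) = a * enorm u.
  by rewrite -(ger0_norm (dot_ge0 u)) -enormZ uG enormZ gtr0_norm.
have eu0 : 0 < enorm u by rewrite enorm_gt0.
have eG0 : 0 < enorm (grad F q) by rewrite enorm_gt0.
rewrite -/u /unit_normal scalerA.
apply: (scalerI (lt0r_neq0 uu0)); rewrite scalerA mulrC -scalerA uG scalerA.
rewrite mulrAC -[LHS]/(dot u u *: u); congr (_ *: u).
by rewrite (mulrC (enorm u)) -eG mulfK ?gt_eqF.
Qed.

Lemma closest_normal F x q : (forall y, differentiable F y) ->
  grad F q != 0 -> closest_point (zero_set F) x q ->
  x - q = dot (x - q) (unit_normal F q) *: unit_normal F q /\
  (0 < F x -> dot (x - q) (unit_normal F q) = enorm (x - q)).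
Proof.
move=> dF G0 xq.
have N1 := dot_unit_normal G0.
have Fc : continuous F by move=> y; exact: differentiable_continuous.
have [Fx|Fx|Fx] := ltgtP (F x) 0; last first.
- by rewrite (closest_self Fx xq) subrr dotE !mxE !mul0r addr0 scale0r.
- have e := closest_unit_normal_pos Fc (dF q) G0 xq Fx.
  suff -> : dot (x - q) (unit_normal F q) = enorm (x - q) by [].
  by rewrite {1}e dotZl N1 mulr1.
- split; last by [].
  have NFc : continuous (fun y => - F y).
    by move=> y; apply: continuousN; exact: Fc.
  have NdF : differentiable (fun y => - F y) q by exact: differentiableN.
  have := @closest_unit_normal_pos (fun y => - F y) x q NFc NdF.
  rewrite gradN// oppr_eq0 zero_setN oppr_gt0 unit_normalN// => /(_ G0 xq Fx) e.
  have -> : dot (x - q) (unit_normal F q) = - enorm (x - q).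
    by rewrite {1}e dotZl dotNl N1 mulrN1.
  by rewrite scaleNr -scalerN.
Qed.

End Gradient.
(** * Curvature and the turning of the normal *)

Section Curvature.
Context {R : realType}.
Implicit Types (x y v q : 'rV[R]_2).
Variables (F : 'rV[R]_2 -> R) (F_smooth : smooth F).

Local Notation slope := (fun y => enorm (grad F y)).
Local Notation inv_slope := (fun y => (enorm (grad F y))^-1).
Local Notation normal i := (fun y => unit_normal F y 0 i).

Let scale_mul (a b : R) : a *: b = a * b. Proof. by []. Qed.

Let partial_differentiable i x : differentiable (partial i F) x.
Proof. exact: (F_smooth [:: i]). Qed.

Let partial2_differentiable i j x : differentiable (partial i (partial j F)) x.
Proof. exact: (F_smooth [:: i; j]). Qed.

Lemma slope_sqr :
  slope * slope = partial 0 F * partial 0 F + partial 1 F * partial 1 F.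
Proof.
apply/funext => y; rewrite !fctE -expr2 enorm_sqr dotE !mxE.
by [].
Qed.

Lemma slope_differentiable x : grad F x != 0 -> differentiable slope x.
Proof.
move=> G0.
have dQ : differentiable (fun y => dot (grad F y) (grad F y)) x.
  have -> : (fun y => dot (grad F y) (grad F y)) = slope * slope.
    by apply/funext => y; rewrite !fctE -expr2 enorm_sqr.
  by rewrite slope_sqr; apply: differentiableD; apply: differentiableM.
apply: (differentiable_comp dQ); apply/derivable1_diffP.
have Q0 : 0 < dot (grad F x) (grad F x) by rewrite lt0r dot_eq0 G0 dot_ge0.
by have [] := is_derive1_sqrt Q0.
Qed.

(** Meant for the slope [enorm (grad F)], whose square is the sum of the squares
    of the partial derivatives. *)
Lemma derive_sqr_sum (f g h : 'rV[R]_2 -> R) x v :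
  derivable f x v -> derivable g x v -> derivable h x v ->
  f * f = g * g + h * h ->
  f x * 'D_v f x = g x * 'D_v g x + h x * 'D_v h x.
Proof.
move=> df dg dh /(congr1 (fun k => 'D_v k x)).
rewrite (deriveM df df) (deriveD (derivableM dg dg) (derivableM dh dh)).
by rewrite (deriveM dg dg) (deriveM dh dh) !scale_mul; lra.
Qed.

Lemma derive_slope x v : grad F x != 0 ->
  enorm (grad F x) * 'D_v slope x =
  partial 0 F x * 'D_v (partial 0 F) x + partial 1 F x * 'D_v (partial 1 F) x.
Proof.
move=> G0; apply: derive_sqr_sum slope_sqr; apply: diff_derivable => //.
exact: slope_differentiable.
Qed.

Let normalE i : normal i = inv_slope * partial i F.
Proof. by apply/funext => y; rewrite !mxE. Qed.

Lemma normal_differentiable i x : grad F x != 0 -> differentiable (normal i) x.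
Proof.
move=> G0; rewrite normalE; apply: differentiableM => //.
apply: differentiableV; first exact: slope_differentiable.
by rewrite enorm_eq0.
Qed.

Lemma derive_inv_mul (f g : 'rV[R]_2 -> R) x v :
  f x != 0 -> derivable f x v -> derivable g x v ->
  'D_v ((fun y => (f y)^-1) * g) x
    = (f x)^-1 * 'D_v g x - g x * (f x)^-2 * 'D_v f x.
Proof.
move=> f0 df dg; rewrite (deriveM (derivableV f0 df) dg) (deriveV f0 df).
by rewrite !scale_mul; ring.
Qed.

Lemma derive_normal i x v : grad F x != 0 ->
  'D_v (normal i) x = (enorm (grad F x))^-1 * 'D_v (partial i F) x
    - partial i F x * (enorm (grad F x))^-2 * 'D_v slope x.
Proof.
move=> G0; rewrite normalE derive_inv_mul//; first by rewrite enorm_eq0.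
  by apply: diff_derivable; exact: slope_differentiable.
exact: diff_derivable.
Qed.

Let unit_derive_algebra (s ds g0 g1 d0 d1 : R) : s != 0 ->
  s * s = g0 * g0 + g1 * g1 -> s * ds = g0 * d0 + g1 * d1 ->
  s^-1 * g0 * (s^-1 * d0 - g0 / s ^+ 2 * ds) +
  s^-1 * g1 * (s^-1 * d1 - g1 / s ^+ 2 * ds) = 0.
Proof.
move=> s0 ss sds.
transitivity (s^-1 ^+ 2 * (g0 * d0 + g1 * d1)
  - s^-1 ^+ 4 * (g0 * g0 + g1 * g1) * (s * ds)); first by field.
by rewrite -ss -sds; field.
Qed.

(** The normal field has constant length. *)
Lemma dot_normal_derive x v : grad F x != 0 ->
  unit_normal F x 0 0 * 'D_v (normal 0) x +
  unit_normal F x 0 1 * 'D_v (normal 1) x = 0.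
Proof.
move=> G0; rewrite !derive_normal// !mxE.
apply: unit_derive_algebra (derive_slope v G0); first by rewrite enorm_eq0.
by have := congr1 (fun f => f x) slope_sqr; rewrite !fctE.
Qed.

(** Rewriting the curvature through the first and second partial derivatives of
    [F] shows that it depends continuously on the point. *)
Lemma curvature_bounded : compact (zero_set F) ->
  (forall x, zero_set F x -> grad F x != 0) ->
  forall x, zero_set F x -> `|curvature F x| <= max_curvature F.
Proof.
move=> cF rF x0 Fx0.
pose DS j : 'rV[R]_2 -> R := inv_slope * (partial 0 F * partial j (partial 0 F)
  + partial 1 F * partial j (partial 1 F)).
pose E i : 'rV[R]_2 -> R := inv_slope * partial i (partial i F)
  - partial i F * (inv_slope * inv_slope) * DS i.
have dE i x : zero_set F x -> differentiable (E i) x.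
  move=> /rF Gx; have dV : differentiable inv_slope x.
    apply: differentiableV; first exact: slope_differentiable.
    by rewrite enorm_eq0.
  have dG j : differentiable (partial j F) x by exact: partial_differentiable.
  have dH j : differentiable (partial i (partial j F)) x.
    exact: partial2_differentiable.
  have dDS : differentiable (DS i) x.
    apply: (differentiableM dV).
    by apply: differentiableD; [exact: (differentiableM (dG 0) (dH 0))|
      exact: (differentiableM (dG 1) (dH 1))].
  apply: differentiableB; first exact: (differentiableM dV (dH i)).
  apply: (differentiableM _ dDS); apply: (differentiableM (dG i)).
  exact: (differentiableM dV dV).
have curvE x : zero_set F x -> curvature F x = E 0 x + E 1 x.
  move=> /rF Gx; have S0 : enorm (grad F x) != 0 by rewrite enorm_eq0.
  have DSE i : 'D_(delta_mx 0 i) slope x = DS i x.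
    apply: (mulfI S0); rewrite (derive_slope _ Gx) /DS.
    by rewrite [in RHS]mulrA -[RHS]/(_ * _ * (_ + _)) divff// mul1r.
  have e i : partial i (normal i) x = E i x.
    rewrite [LHS](derive_normal i (delta_mx 0 i) Gx) DSE expr2 invfM.
    exact: erefl.
  rewrite /curvature -!e !big_ord_recl big_ord0 addr0; congr (_ + _).
  by rewrite (_ : lift _ _ = 1)//; exact: val_inj.
have cE : {within zero_set F, continuous (fun x => `|E 0 x + E 1 x|)}.
  apply: continuous_in_subspaceT => x; rewrite inE => Fx.
  apply: (@continuous_comp _ _ _ (E 0 + E 1) (fun r : R => `|r|)).
    by apply: differentiable_continuous; apply: differentiableD; exact: dE.
  exact: norm_continuous.
clearbody E; have [c _ cmax] := compact_EVT_max (ex_intro _ x0 Fx0) cF cE.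
apply: ub_le_sup; last by exists x0.
exists `|E 0 c + E 1 c| => _ [x Fx <-].
rewrite (curvE x Fx); apply: cmax; exact: mem_set.
Qed.

(** A linear map whose image is orthogonal to the unit vector [n] multiplies the
    tangent vector [perp n] by the trace. *)
Lemma orthogonal_image_le (A : 'I_2 -> 'rV[R]_2) n v : dot n n = 1 ->
  (forall j, n 0 0 * A 0 0 j + n 0 1 * A 1 0 j = 0) ->
  enorm (\row_i dot (A i) v) <= `|A 0 0 0 + A 1 0 1| * enorm v
    + `|dot v n| * enorm (\row_i dot (A i) n).
Proof.
move=> n1 nA; set k := A 0 0 0 + _; set W := fun u => \row_i dot (A i) u.
have Wtangent : W (perp n) = k *: perp n.
  have := nA 0; have := nA 1; rewrite /k => nA1 nA0.
  by apply: row2P; rewrite 2!mxE dotE ?perp0 ?perp1; lra.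
have -> : \row_i dot (A i) v = dot v (perp n) *: W (perp n) + dot v n *: W n.
  apply/rowP => i; rewrite [LHS]mxE {1}(frame_decomp v n1) dotDr !dotZr.
  by rewrite addrC !mxE.
rewrite (le_trans (ler_enormD _ _))// !enormZ lerD2r Wtangent enormZ enorm_perp.
have en1 : enorm n = 1 by rewrite enormE n1 sqrtr1.
rewrite en1 mulr1 mulrC ler_wpM2l//.
by have := dot_le_enorm v (perp n); rewrite enorm_perp en1 mulr1.
Qed.

(** The derivative of the normal field takes values orthogonal to the normal, so
    on the tangent line it is multiplication by its trace, the curvature; and a
    chord from [q0] to a point of the curve is tangent to first order. *)
Lemma normal_turning q0 e : zero_set F q0 -> grad F q0 != 0 -> 0 < e ->
  exists2 d, 0 < d & forall q, zero_set F q -> enorm (q - q0) < d ->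
    `|dot (q - q0) (unit_normal F q0)| <= e * enorm (q - q0) /\
    enorm (unit_normal F q - unit_normal F q0)
      <= (`|curvature F q0| + e) * enorm (q - q0).
Proof.
move=> Fq0 G0 e0; set n := unit_normal F q0; set k := curvature F q0.
have n1 : dot n n = 1 := dot_unit_normal G0.
pose A i := grad (normal i) q0.
have kE : k = A 0 0 0 + A 1 0 1.
  rewrite !mxE /k /curvature !big_ord_recl big_ord0 addr0; congr (_ + _).
  by rewrite (_ : lift _ _ = 1)//; exact: val_inj.
have nA j : n 0 0 * A 0 0 j + n 0 1 * A 1 0 j = 0.
  by rewrite [A 0 0 j]mxE [A 1 0 j]mxE; exact: dot_normal_derive.
pose W v : 'rV[R]_2 := \row_i dot (A i) v.
(* [e1] controls the normal component of the chord, which [W] stretches by at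
   most [C]. *)
pose C := enorm (W n) + 1; have C0 : 0 < C by rewrite ltr_wpDl ?enorm_ge0.
pose e1 := Num.min e (e / (2 * C)).
have e10 : 0 < e1 by rewrite lt_min e0 divr_gt0// mulr_gt0.
have e1e : e1 <= e by rewrite ge_min lexx.
have e1C : e1 * C <= e / 2.
  rewrite -ler_pdivlMr// -mulrA -invfM.
  by rewrite /e1 ge_min lexx orbT.
have g0 : 0 < enorm (grad F q0) by rewrite enorm_gt0.
have [d d0 Fd] := grad_approx (F_smooth [::] q0) (mulr_gt0 e10 g0).
have e4 : 0 < e / 4 by rewrite divr_gt0.
have [d' d'0 Nd0] := grad_approx (normal_differentiable 0 G0) e4.
have [d'' d''0 Nd1] := grad_approx (normal_differentiable 1 G0) e4.
exists (Num.min d (Num.min d' d'')) => [|q Fq]; first by rewrite !lt_min d0 d'0.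
rewrite !lt_min => /and3P[qd qd' qd'']; set D := q - q0.
have Dge0 := enorm_ge0 D.
have Dn : `|dot D n| <= e1 * enorm D.
  have := Fd q qd; rewrite /= [F q]Fq [F q0]Fq0 subrr sub0r normrN -/D dotC => FD.
  rewrite /n /unit_normal dotZr normrM ger0_norm ?invr_ge0 ?enorm_ge0//.
  by rewrite [leLHS]mulrC ler_pdivrMr// [leRHS]mulrAC.
split; first by rewrite (le_trans Dn)// ler_wpM2r.
have W_le : enorm (W D) <= (`|k| + e / 2) * enorm D.
  rewrite (le_trans (orthogonal_image_le D n1 nA))// -kE.
  have : `|dot D n| * enorm (W n) <= e1 * enorm D * C.
    by rewrite ler_pM ?enorm_ge0// lerDl.
  have : e1 * C * enorm D <= e / 2 * enorm D by rewrite ler_wpM2r.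
  rewrite /W; lra.
have := enorm_le_coords (unit_normal F q - n - W D).
have := ler_enormD (unit_normal F q - n - W D) (W D); rewrite subrK.
have cE i : (unit_normal F q - n - W D) 0 i =
    unit_normal F q 0 i - n 0 i - dot (A i) D by rewrite !mxE.
have := Nd0 q qd'; have := Nd1 q qd''; rewrite !cE -/D -/n -/(A _).
lra.
Qed.

End Curvature.
(** * The signed distance near the curve *)

Section FrameVariation.
Context {R : realType}.
Implicit Types (x q n : 'rV[R]_2).

(** To first order the displacement of [x = q + s *: n] splits into that of its
    foot [q], which is tangential, and that of the segment from [q] to [x]. The
    tangential part of the latter is at most [h * K <= 1/4] times the
    displacement of the foot, so the foot moves at most [1 / (1 - 3/10)] times
    as fast as [x], where [3/10] is [1/4] plus room for the error terms. *)
Lemma foot_displacement x0 x q0 q n0 n (s0 s h K e : R) :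
  dot n0 n0 = 1 -> x0 - q0 = s0 *: n0 -> x - q = s *: n ->
  0 <= h -> 0 <= K -> h * K <= 4^-1 -> 0 < e -> e * (h + 2) <= 100^-1 ->
  enorm (x - x0) <= 1 -> (K + 1) * enorm (x - x0) <= 100^-1 ->
  `|s| <= h + enorm (x - x0) ->
  `|dot (q - q0) n0| <= e * enorm (q - q0) ->
  enorm (n - n0) <= (K + e) * enorm (q - q0) ->
  enorm (q - q0) <= 10 / 7 * enorm (x - x0).
Proof.
move=> n01 xq0 xq h0 K0 hK e0 eh X1 KX sh Dn nn.
have Dt : dot (q - q0) (perp n0)
    = dot (x - x0) (perp n0) - s * dot (n - n0) (perp n0).
  by rewrite (sub_split xq xq0) !dotDl !dotZl !dotDl dot_perp; ring.
have ep : enorm (perp n0) = 1 by rewrite enorm_perp enormE n01 sqrtr1.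
have a1 := dot_le_enorm (x - x0) (perp n0).
have a2 := dot_le_enorm (n - n0) (perp n0).
rewrite ep mulr1 in a1; rewrite ep mulr1 in a2; have a3 := le_trans a2 nn.
have := enorm_le_frame (q - q0) n01; rewrite Dt.
set X := enorm (x - x0) in X1 KX sh a1 *; set Y := enorm (q - q0) in Dn nn a3 *.
have X0 : 0 <= X := enorm_ge0 _.
have Y0 : 0 <= Y := enorm_ge0 _.
move=> Yle.
have b1 : `|dot (x - x0) (perp n0) - s * dot (n - n0) (perp n0)|
    <= X + (h + X) * ((K + e) * Y).
  apply: (le_trans (ler_normB _ _)); apply: lerD => //.
  by rewrite normrM; apply: ler_pM.
have b2 : (h + X) * (K + e) * Y <= (4^-1 + 2 / 100) * Y.
  rewrite ler_wpM2r//.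
  have : X * e <= 1 * e by rewrite ler_wpM2r// ltW.
  by lra.
have b3 : e * Y <= 100^-1 * Y.
  by rewrite ler_wpM2r//; have := mulr_ge0 (ltW e0) h0; lra.
lra.
Qed.

(** The component along [n0] of that splitting; [dot n n0] differs from [1] only
    to second order because both vectors are unit vectors. *)
Lemma height_variation x0 x q0 q n0 n (s0 s : R) :
  dot n0 n0 = 1 -> dot n n = 1 -> x0 - q0 = s0 *: n0 -> x - q = s *: n ->
  s - s0 - dot (x - x0) n0 = s * (enorm (n - n0) ^+ 2 / 2) - dot (q - q0) n0.
Proof.
move=> n01 n1 xq0 xq.
have -> : enorm (n - n0) ^+ 2 / 2 = 1 - dot n n0.
  by rewrite enorm_sqr dotBl !dotBr n1 n01 (dotC n0); field.
rewrite (sub_split xq xq0) !dotDl !dotZl !dotDl !dotNl n01; ring.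
Qed.

End FrameVariation.

Section SignedDistance.
Context {R : realType}.
Variables (F : 'rV[R]_2 -> R) (h r K : R).
Implicit Types (x y p q o : 'rV[R]_2) (e : R).
Hypothesis F_diff : forall x, differentiable F x.
Hypothesis gamma_compact : compact (zero_set F).
Hypothesis gamma_regular : forall x, zero_set F x -> grad F x != 0.
Hypothesis gamma_reach : forall x, dist x (zero_set F) < r ->
  exists! p, closest_point (zero_set F) x p.
Hypothesis K_ge0 : 0 <= K.
Hypothesis gamma_turning : forall q0 e, zero_set F q0 -> 0 < e ->
  exists2 d, 0 < d & forall q, zero_set F q -> enorm (q - q0) < d ->
    `|dot (q - q0) (unit_normal F q0)| <= e * enorm (q - q0) /\
    enorm (unit_normal F q - unit_normal F q0) <= (K + e) * enorm (q - q0).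
Hypothesis h_lt_r : h < r.
Hypothesis hK_le : h * K <= 4^-1.

Definition foot x := xget 0 (closest_point (zero_set F) x).

Definition foot_normal x := unit_normal F (foot x).

Definition signed_dist x := dot (x - foot x) (foot_normal x).

Lemma footP x : dist x (zero_set F) < r -> closest_point (zero_set F) x (foot x).
Proof. by move=> /gamma_reach[q [xq _]]; apply: xgetI xq. Qed.

Lemma foot_uniq x q : dist x (zero_set F) < r ->
  closest_point (zero_set F) x q -> q = foot x.
Proof.
move=> xr xq; have [q' [_ uq]] := gamma_reach xr.
by rewrite -(uq _ xq) -(uq _ (footP xr)).
Qed.

Lemma foot_id p : zero_set F p -> dist p (zero_set F) < r -> foot p = p.
Proof. by move=> Fp pr; exact: closest_self (footP pr). Qed.

Lemma foot_decomp x : dist x (zero_set F) < r ->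
  x - foot x = signed_dist x *: foot_normal x.
Proof.
by move=> /footP xq; have [] := closest_normal F_diff (gamma_regular xq.1) xq.
Qed.

Lemma signed_dist_pos x : dist x (zero_set F) < r -> 0 < F x ->
  signed_dist x = dist x (zero_set F).
Proof.
move=> /footP xq Fx; rewrite -xq.2.
by have [_ /(_ Fx)] := closest_normal F_diff (gamma_regular xq.1) xq.
Qed.

Lemma foot_normal1 x : dist x (zero_set F) < r ->
  dot (foot_normal x) (foot_normal x) = 1.
Proof. by move=> /footP[xq _]; exact: dot_unit_normal (gamma_regular xq). Qed.

Lemma norm_signed_dist x : dist x (zero_set F) < r ->
  `|signed_dist x| = dist x (zero_set F).
Proof.
move=> xr; rewrite -(footP xr).2 foot_decomp// enormZ.
by rewrite [enorm (foot_normal _)]enormE foot_normal1// sqrtr1 mulr1.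
Qed.

(** By [foot_displacement] the foot, hence also the normal at the foot, moves at a
    bounded rate; so [foot_normal x0] is the gradient of the signed distance, as
    [height_variation] leaves only terms of higher order. These are the two
    ingredients of a second-order Taylor estimate. *)
Lemma foot_variation x0 e : dist x0 (zero_set F) <= h -> 0 < e ->
  exists2 d, 0 < d & forall x, enorm (x - x0) < d ->
    enorm (foot_normal x - foot_normal x0)
      <= 10 / 7 * (K + e) * enorm (x - x0) /\
    `|signed_dist x - signed_dist x0 - dot (x - x0) (foot_normal x0)|
      <= e * enorm (x - x0).
Proof.
move=> x0h e0; have x0r := le_lt_trans x0h h_lt_r.
have h0 : 0 <= h := le_trans (dist_ge0 _ _) x0h.
(* [e1] bounds the first-order errors on the curve, [M] the coefficient of the
   quadratic error in [height_variation]. *)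
pose e1 := Num.min (e / 4) (100 * (h + 2))^-1.
have e10 : 0 < e1 by rewrite lt_min divr_gt0//= invr_gt0 mulr_gt0// ltr_wpDl.
have e1e : e1 <= e / 4 by rewrite ge_min lexx.
have e1h : e1 * (h + 2) <= 100^-1.
  by rewrite -ler_pdivlMr ?ltr_wpDl// -invfM ge_min lexx orbT.
have [d1 d10 turn] := gamma_turning (footP x0r).1 e10.
have /enorm_nbhsP/(closest_point_continuous gamma_compact (footP x0r))
    : exists2 d, 0 < d &
        forall y, enorm (y - foot x0) < d -> enorm (y - foot x0) < d1.
  by exists d1.
case=> [q qx|d2 d20 near_q0]; first exact: foot_uniq.
pose M := 4 * (h + 1) * (K + e + 1) ^+ 2.
have M0 : 0 < M.
  have [h1 K1] : 0 < h + 1 /\ 0 < K + e + 1 by move: K_ge0; lra.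
  by rewrite mulr_gt0 ?exprn_gt0// mulr_gt0.
pose d := Num.min (Num.min d2 (r - h))
  (Num.min (100 * (K + 1))^-1 (Num.min 1 (e / M))).
exists d => [|x].
  rewrite !lt_min d20 subr_gt0 h_lt_r ltr01 divr_gt0// invr_gt0.
  by rewrite mulr_gt0// ltr_wpDl.
rewrite /d !lt_min => /andP[/andP[xd2 xrh] /and3P[xK x1 xM]].
have X0 : 0 <= enorm (x - x0) := enorm_ge0 _.
have xx0 : dist x (zero_set F) <= h + enorm (x - x0).
  rewrite (le_trans (dist_le _ (footP x0r).1))// (le_trans (ler_enormB3 _ x0 _))//.
  by rewrite addrC lerD2r (footP x0r).2.
have xr : dist x (zero_set F) < r by lra.
have sh : `|signed_dist x| <= h + enorm (x - x0) by rewrite norm_signed_dist.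
have [Dn nn] := turn _ (footP xr).1 (near_q0 _ _ xd2 (footP xr)).
have KX : (K + 1) * enorm (x - x0) <= 100^-1.
  by rewrite mulrC -ler_pdivlMr ?ltr_wpDl// -invfM ltW.
have Yle := foot_displacement (foot_normal1 x0r) (foot_decomp x0r)
  (foot_decomp xr) h0 K_ge0 hK_le e10 e1h (ltW x1) KX sh Dn nn.
rewrite (height_variation (foot_normal1 x0r) (foot_normal1 xr)
  (foot_decomp x0r) (foot_decomp xr)).
move: Dn nn Yle sh; rewrite -/(foot_normal x) -/(foot_normal x0).
move: (signed_dist x) (foot x - foot x0) (foot_normal x) (foot_normal x0).
move=> s D n n0; set X := enorm (x - x0) in xd2 xrh xK x1 xM X0 KX xx0 *.
move=> Dn nn Yle sh.
have nnX : enorm (n - n0) <= 10 / 7 * (K + e1) * X.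
  have : (K + e1) * enorm D <= (K + e1) * (10 / 7 * X).
    by rewrite ler_wpM2l// addr_ge0// ltW.
  lra.
split; first by rewrite (le_trans nnX)// ler_wpM2r// ler_wpM2l//; lra.
rewrite (le_trans (ler_normB _ _))//.
have D_le : `|dot D n0| <= e / 4 * (10 / 7 * X).
  by rewrite (le_trans Dn)// ler_pM ?enorm_ge0// ltW.
have quad : `|s * (enorm (n - n0) ^+ 2 / 2)| <= e / 2 * X.
  have t2 : enorm (n - n0) ^+ 2 / 2 <= 2 * (K + e + 1) ^+ 2 * X * X.
    have : enorm (n - n0) <= 2 * (K + e + 1) * X.
      by rewrite (le_trans nnX)// ler_wpM2r//; move: K_ge0; lra.
    move=> h1; have := ler_pM (enorm_ge0 _) (enorm_ge0 _) h1 h1.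
    rewrite -expr2; lra.
  have t0 : 0 <= enorm (n - n0) ^+ 2 / 2 by rewrite divr_ge0// sqr_ge0.
  rewrite normrM (ger0_norm t0) (le_trans (ler_pM _ t0 sh t2))//.
  have XM : X * M <= e by rewrite -ler_pdivlMr// ltW.
  have : X * (X * M) <= X * e by rewrite ler_wpM2l.
  have : X * (X * ((K + e + 1) ^+ 2 * X)) <= X * (X * ((K + e + 1) ^+ 2 * 1)).
    by rewrite !ler_wpM2l// ?sqr_ge0// ltW.
  rewrite /M; lra.
have : 0 <= e * X by rewrite mulr_ge0// ltW.
lra.
Qed.

(** Let [f] be the signed distance along the segment from [p] to [o]. Then
    [f 0 = 0], [f' 0 = g 0 = dot (o - p) (foot_normal p)], and [g = f'] grows at
    rate at most [C <= 10/7 * (K + e) * h ^ 2]. If [g 0 <= 0] then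
    [f 1 <= C / 2 + e * h <= 5/7 * (K + e) * h ^ 2 + e * h], which for small [e]
    is less than the distance [f 1] of [o]. *)
Lemma far_point_side p o : zero_set F p -> enorm (o - p) <= h ->
  K * h ^+ 2 < dist o (zero_set F) -> 0 < F o -> 0 < dot (o - p) (grad F p).
Proof.
move=> Fp; set w := o - p => wh far Fo.
have h0 : 0 <= h := le_trans (enorm_ge0 _) wh.
have L0 := enorm_ge0 w.
have distp t : 0 <= t <= 1 -> dist (p + t *: w) (zero_set F) <= h.
  move=> /andP[t0 t1]; rewrite (le_trans (dist_le _ Fp))// addrAC subrr add0r.
  by rewrite enormZ ger0_norm// (le_trans (ler_piMl _ _)).
have reachp t : 0 <= t <= 1 -> dist (p + t *: w) (zero_set F) < r.
  by move=> /distp /le_lt_trans; exact.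
have gp : 0 < enorm (grad F p) by rewrite enorm_gt0 gamma_regular.
have p0 : p + 0 *: w = p by rewrite scale0r addr0.
have p1 : p + 1 *: w = o by rewrite scale1r /w subrKC.
have [I0 I1] : 0 <= (0:R) <= 1 /\ 0 <= (1:R) <= 1 by rewrite !lexx ler01.
have foot0 : foot p = p.
  by apply: foot_id => //; rewrite -[X in dist X]p0 reachp.
suff: 0 < dot w (foot_normal p).
  rewrite /foot_normal foot0 /unit_normal dotZr pmulr_rgt0// invr_gt0//.
pose D := dist o (zero_set F); rewrite -/D in far.
(* The slack [D - K * h ^+ 2] pays for the errors [5/7 * e * h ^+ 2 + e * h]. *)
pose e := (D - K * h ^+ 2) / (h ^+ 2 + h + 1).
have E0 : 0 < h ^+ 2 + h + 1 by have := sqr_ge0 h; lra.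
have e0 : 0 < e by rewrite divr_gt0// subr_gt0.
have eE : e * (h ^+ 2 + h + 1) = D - K * h ^+ 2 by rewrite divfK// gt_eqF.
pose C := 10 / 7 * (K + e) * enorm w ^+ 2.
have C0 : 0 <= C by rewrite !mulr_ge0 ?sqr_ge0// addr_ge0// ltW.
pose g t := dot w (foot_normal (p + t *: w)).
pose f t := signed_dist (p + t *: w).
rewrite ltNge; apply/negP => w_le0.
have variation t : 0 <= t <= 1 -> exists2 d, 0 < d & forall s, `|s - t| < d ->
    `|g s - g t| <= C * `|s - t| /\
    `|f s - f t - (s - t) * g t| <= e * h * `|s - t|.
  move=> /distp tI; have [d d0 vard] := foot_variation tI e0.
  exists (d / (enorm w + 1)) => [|s]; first by rewrite divr_gt0// ltr_wpDl.
  rewrite ltr_pdivlMr ?ltr_wpDl// => std.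
  have sub_path : p + s *: w - (p + t *: w) = (s - t) *: w.
    by rewrite opprD addrACA subrr add0r scalerBl.
  have := vard (p + s *: w); rewrite sub_path enormZ dotZl -/(f s) -/(f t) -/(g t).
  case=> [|nd fd].
    by rewrite (le_lt_trans _ std)// ler_wpM2l// lerDl.
  split.
    rewrite /g -dotBr (le_trans (dot_le_enorm _ _))//.
    rewrite (le_trans (ler_wpM2l L0 nd))// /C; lra.
  by rewrite (le_trans fd)// -mulrA (ler_wpM2l (ltW e0))// mulrC ler_wpM2r.
have f0 : f 0 = 0 by rewrite /f p0 /signed_dist foot0 subrr dotE !mxE; ring.
have f1D : f 1 = D.
  by rewrite /f p1; apply: signed_dist_pos => //; have := reachp 1 I1; rewrite p1.
have Lh : enorm w ^+ 2 <= h ^+ 2 by rewrite ler_pXn2r ?nnegrE.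
have CK : C <= 10 / 7 * ((K + e) * h ^+ 2).
  by rewrite /C -mulrA ler_wpM2l// ler_wpM2l// addr_ge0// ltW.
have g0 : g 0 <= 0 by rewrite /g p0.
clearbody C e f g D.
have gc t : 0 <= t <= 1 -> {for t, continuous g}.
  move=> /variation[d d0 vd]; apply: (@lipschitz_at_continuous _ _ _ C d) => // s.
  by case/vd.
have fc t : 0 <= t <= 1 -> {for t, continuous f}.
  move=> /variation[d d0 vd].
  apply: (@lipschitz_at_continuous _ _ _ (e * h + `|g t|) d) => // s.
  case/vd => _ fd; rewrite -(subrK ((s - t) * g t) (f s - f t)).
  by rewrite (le_trans (ler_normD _ _))// [leRHS]mulrDl lerD// normrM mulrC.
have g_le t : 0 <= t <= 1 -> g t <= C * t.
  move=> /andP[t0 t1].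
  have : g t - C * t <= g 0 - C * 0.
    apply: (@right_nonincr _ 0 t (fun s => g s - C * s)) => //.
      move=> s /andP[s0 st]; apply: cvgB; first by apply: gc; rewrite s0 (le_trans st).
      by apply: cvgM; [exact: cvg_cst|exact: cvg_id].
    move=> s /andP[s0 st].
    have [|d d0 vd] := variation s; first by rewrite s0 ltW// (lt_le_trans st).
    exists d => // u /andP[su ud].
    have us0 : 0 < u - s by rewrite subr_gt0.
    have [|gu _] := vd u; first by rewrite gtr0_norm// ltrBlDl.
    move: gu; rewrite ler_norml (gtr0_norm us0) => /andP[_].
    move: (g u) (g s) => gu gs; lra.
  rewrite mulr0 subr0 => gt0; have := le_trans gt0 g0.
  by rewrite subr_le0.
have f1 : f 1 - (C / 2 * 1 ^+ 2 + e * h * 1)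
    <= f 0 - (C / 2 * 0 ^+ 2 + e * h * 0).
  apply: (@right_nonincr _ 0 1
    (fun s => f s - (C / 2 * s ^+ 2 + e * h * s))) => //.
    move=> s sI; apply: cvgB; first exact: fc.
    apply: cvgD; apply: cvgM; [exact: cvg_cst| |exact: cvg_cst|exact: cvg_id].
    exact: exprn_continuous.
  move=> s /andP[s0 s1]; have sI : 0 <= s <= 1 by rewrite s0 ltW.
  have [d d0 vd] := variation s sI; have gs := g_le s sI.
  exists d => // u /andP[su ud].
  have us0 : 0 < u - s by rewrite subr_gt0.
  have [|_] := vd u; first by rewrite gtr0_norm// ltrBlDl.
  rewrite ler_norml (gtr0_norm us0) => /andP[_].
  move: (g s) (f u) (f s) gs => gs fu fs gs_le fus.
  have : (u - s) * gs <= (u - s) * (C * s) by rewrite ler_wpM2l// ltW.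
  have : 0 <= C * ((u - s) * (u - s)) by rewrite mulr_ge0// -expr2 sqr_ge0.
  lra.
have := mulr_ge0 K_ge0 (sqr_ge0 h); have := mulr_ge0 (ltW e0) (sqr_ge0 h).
move: f1; rewrite f0 f1D.
lra.
Qed.

End SignedDistance.
(** * Triangles and central projection *)

Section Triangle.
Context {R : realType}.
Variables o0 o1 o2 : 'rV[R]_2.
Implicit Types (p q m v : 'rV[R]_2) (F : 'rV[R]_2 -> R).
Local Notation T := (triangle o0 o1 o2).

Lemma vertex0 : T o0.
Proof. by exists 1, 0, 0; rewrite !addr0 scale1r !scale0r !addr0; split. Qed.

Lemma vertex1 : T o1.
Proof.
by exists 0, 1, 0; rewrite addr0 add0r scale1r !scale0r addr0 add0r; split.
Qed.

Lemma vertex2 : T o2.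
Proof. by exists 0, 0, 1; rewrite !add0r scale1r !scale0r !add0r; split. Qed.

Lemma triangle_le_diam p q : T p -> T q -> enorm (p - q) <= diam T.
Proof.
move=> Tp Tq; apply: ub_le_sup; last by exists (p, q).
pose M := enorm o0 + enorm o1 + enorm o2.
have T_le x : T x -> enorm x <= M.
  move=> [a [b [c [a0 b0 c0 abc ->]]]].
  rewrite (le_trans (ler_enormD _ _))// lerD//; last first.
    by rewrite enormZ ger0_norm// ler_piMl ?enorm_ge0//; lra.
  rewrite (le_trans (ler_enormD _ _))// lerD// enormZ ger0_norm//.
    by rewrite ler_piMl ?enorm_ge0//; lra.
  by rewrite ler_piMl ?enorm_ge0//; lra.
exists (M + M) => _ [[x y] [/= /T_le xM /T_le yM] <-].
by rewrite (le_trans (ler_enormD _ _))// enormN lerD.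
Qed.

Lemma dot_barycentric p v a b c : a + b + c = 1 ->
  p = a *: o0 + b *: o1 + c *: o2 ->
  a * dot (o0 - p) v + b * dot (o1 - p) v + c * dot (o2 - p) v = 0.
Proof.
move=> abc ->; have -> : a = 1 - b - c by rewrite -abc; ring.
by rewrite !dotE !mxE; ring.
Qed.

Lemma cone_triangle m u : segment o1 o2 m -> 0 <= u <= 1 ->
  T (o0 + u *: (m - o0)).
Proof.
move=> [t [t0 t1 ->]] /andP[u0 u1].
exists (1 - u), (u * (1 - t)), (u * t); split.
- by rewrite subr_ge0.
- by rewrite mulr_ge0// subr_ge0.
- exact: mulr_ge0.
- by ring.
- by apply/rowP => i; rewrite !mxE; ring.
Qed.

Lemma segment_triangle m : segment o1 o2 m -> T m.
Proof.
move=> sm; rewrite -[m](subrKC o0) -[m - o0]scale1r.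
by apply: cone_triangle; rewrite ?lexx ?ler01.
Qed.

Lemma nondegenerate_coords a b : triangle_nondegenerate o0 o1 o2 ->
  a *: (o1 - o0) + b *: (o2 - o0) = 0 -> a = 0 /\ b = 0.
Proof.
move=> /freeP free_o ab.
have := free_o (fun i : 'I_2 => if i == 0 then a else b).
rewrite !big_ord_recl big_ord0 /= addr0 => /(_ ab) k0.
by split; [exact: (k0 0)|exact: (k0 1)].
Qed.

Lemma central_projection p : triangle_nondegenerate o0 o1 o2 -> T p ->
  p != o0 -> exists m u, [/\ segment o1 o2 m, 0 <= u <= 1,
    p = o0 + u *: (m - o0) & ray o0 p `&` segment o1 o2 = [set m]].
Proof.
move=> nd [a [b [c [a0 b0 c0 abc pE]]]] po0.
have pE' : p - o0 = b *: (o1 - o0) + c *: (o2 - o0).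
  have aE : a = 1 - b - c by rewrite -abc; ring.
  by rewrite pE aE; apply/rowP => i; rewrite !mxE; ring.
have bc0 : 0 < b + c.
  rewrite lt0r addr_ge0// andbT; apply: contraNneq po0 => bc.
  have [b_eq0 c_eq0] : b = 0 /\ c = 0 by lra.
  by rewrite -subr_eq0 pE' b_eq0 c_eq0 !scale0r addr0.
have bcN0 : b + c != 0 by rewrite gt_eqF.
pose m := o0 + (b + c)^-1 *: (p - o0).
have mE : m = (1 - c / (b + c)) *: o1 + (c / (b + c)) *: o2.
  by rewrite /m pE'; apply/rowP => i; rewrite !mxE; field.
have sm : segment o1 o2 m.
  exists (c / (b + c)); split => //; first by rewrite divr_ge0// ltW.
  by rewrite ler_pdivrMr// mul1r lerDr.
exists m, (b + c); split => //.
- by rewrite ltW//= -abc -addrA lerDr.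
- by rewrite [m - o0]addrAC subrr add0r scalerA divff// scale1r subrKC.
apply/seteqP; split=> [y [[s [s0 yE]] [t [t0 t1 yE']]]|_ ->]; last first.
  by split => //; exists (b + c)^-1; split; first by rewrite invr_ge0 ltW.
have : (s * b - (1 - t)) *: (o1 - o0) + (s * c - t) *: (o2 - o0) = 0.
  have := yE; rewrite yE' pE' => /rowP e.
  by apply/rowP => i; have := e i; rewrite !mxE; lra.
move=> /(nondegenerate_coords nd)[sb sc].
have -> : y = m => //; rewrite /m yE; congr (_ + _ *: _).
apply: (mulIf bcN0); rewrite mulVf//; lra.
Qed.

(** The tangent line at each zero [p] of [F] in the triangle separates [o0] from
    [o1] and [o2], so along each segment from [o0] to the opposite edge [F]
    crosses zero only upwards, hence exactly once. *)
Lemma central_projection_bij F : triangle_nondegenerate o0 o1 o2 ->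
  (forall x, differentiable F x) -> F o0 < 0 -> 0 < F o1 ->
  (forall p, T p -> F p = 0 -> [/\ dot (o0 - p) (grad F p) < 0,
     0 < dot (o1 - p) (grad F p) & 0 < dot (o2 - p) (grad F p)]) ->
  exists phi : 'rV[R]_2 -> 'rV[R]_2,
    (forall p, (T `&` zero_set F) p ->
       ray o0 p `&` segment o1 o2 = [set phi p]) /\
    set_bij (T `&` zero_set F) (segment o1 o2) phi.
Proof.
move=> nd dF Fo0 Fo1 side.
have Fc : continuous F by move=> x; exact: differentiable_continuous.
have edge_neq0 m : segment o1 o2 m -> F m <> 0.
  move=> sm Fm; have [_ d1 d2] := side m (segment_triangle sm) Fm.
  have [t [t0 t1 mE]] := sm.
  have := @dot_barycentric m (grad F m) 0 (1 - t) t.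
  rewrite scale0r !add0r subrK mul0r add0r => /(_ erefl mE).
  by move: d1 d2; move: (dot _ _) (dot _ _) => x y; nra.
have edge_gt0 m : segment o1 o2 m -> 0 < F m.
  move=> sm; rewrite ltNge; apply/negP => Fm.
  have [|s /andP[s0 s1]] := @segment_zero _ F m o1 Fc; first by rewrite Fm ltW.
  have [t [t0 t1 mE]] := sm; apply: edge_neq0.
  exists (t * (1 - s)); split.
  - by rewrite mulr_ge0// subr_ge0.
  - by rewrite (le_trans (ler_piMr _ _))// lerBlDr lerDl.
  - by rewrite mE; apply/rowP => i; rewrite !mxE; ring.
have zero_uniq m u u' : segment o1 o2 m -> 0 <= u -> u <= u' -> u' <= 1 ->
    F (o0 + u *: (m - o0)) = 0 -> F (o0 + u' *: (m - o0)) = 0 -> u = u'.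
  move=> sm u0 uu' u'1.
  apply: (@increasing_zero_uniq _ u u' (fun t => F (o0 + t *: (m - o0)))) => //.
    by move=> t _; exact: line_comp_continuous.
  move=> t /andP[ut tu'] Ft; set P := o0 + t *: (m - o0).
  have TP : T P.
    by apply: cone_triangle; rewrite ?(le_trans u0 ut)// (le_trans tu').
  have [d0 d1 d2] := side P TP Ft; have [s [s0 s1 mE]] := sm.
  have [|d d_gt0 Fd] := @increase_along _ F P (m - o0) (dF P).
    have -> : m - o0 = (1 - s) *: (o1 - P) + s *: (o2 - P) - (o0 - P).
      by rewrite mE; apply/rowP => i; rewrite !mxE; ring.
    rewrite dotC (dotBl (_ + _)) (dotDl (_ *: _)) !dotZl.
    by move: d0 d1 d2; move: (dot _ _) (dot _ _) (dot _ _) => x y z; nra.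
  exists d => //; rewrite -[F P]/(F P) in Fd.
  split=> v /andP[v1 v2].
    have [|+ _] := Fd (v - t); first by rewrite subr_gt0 v1 ltrBlDl.
    by rewrite Ft -addrA -scalerDl subrKC.
  have [|_] := Fd (t - v); first by rewrite subr_gt0 v2 ltrBlDl -ltrBlDr.
  by rewrite Ft -addrA -scalerBl subKr.
pose phi p := xget 0 (ray o0 p `&` segment o1 o2).
have proj p : (T `&` zero_set F) p -> exists2 u, 0 <= u <= 1 &
    [/\ segment o1 o2 (phi p), p = o0 + u *: (phi p - o0) &
        ray o0 p `&` segment o1 o2 = [set phi p]].
  move=> [Tp Fp].
  have po0 : p != o0.
    by apply/eqP => e; move: Fo0; rewrite -e [F p]Fp ltxx.
  have [m [u [sm uI pE mE]]] := central_projection nd Tp po0.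
  suff -> : phi p = m by exists u.
  have : (ray o0 p `&` segment o1 o2) (phi p).
    by apply: (@xgetPex _ 0); exists m; rewrite mE.
  by rewrite mE.
exists phi; split=> [p /proj[u _ []//]|]; split.
- by move=> p /proj[u _ []].
- move=> p p'; rewrite !inE => Ap Ap'.
  have [u /andP[u0 u1] [sm pE _]] := proj p Ap.
  have [u' /andP[u'0 u'1] [_ p'E _]] := proj p' Ap'.
  move=> e; rewrite -e in p'E.
  have Fp : F (o0 + u *: (phi p - o0)) = 0 by rewrite -pE; exact: Ap.2.
  have Fp' : F (o0 + u' *: (phi p - o0)) = 0 by rewrite -p'E; exact: Ap'.2.
  rewrite [LHS]pE [RHS]p'E; congr (_ + _ *: _).
  have [uu'|/ltW u'u] := leP u u'; first exact: (zero_uniq (phi p)).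
  by apply/esym; exact: (zero_uniq (phi p)).
- move=> m sm.
  have [|u uI Fu] := @segment_zero _ F o0 m Fc.
    by rewrite !ltW// edge_gt0.
  have TA : (T `&` zero_set F) (o0 + u *: (m - o0)).
    by split => //; exact: cone_triangle.
  exists (o0 + u *: (m - o0)) => //.
  have [_ _ [_ _ rE]] := proj _ TA.
  have : (ray o0 (o0 + u *: (m - o0)) `&` segment o1 o2) m.
    split=> //; exists u^-1; split; first by rewrite invr_ge0; case/andP: uI.
    have u0 : u != 0.
      by apply: contraTneq Fo0 => u0; rewrite -leNgt -Fu u0 scale0r addr0.
    by rewrite addrAC subrr add0r scalerA mulVf// scale1r subrKC.
  by rewrite rE.
Qed.

End Triangle.
Lemma convex_comb_gt0 (R : realFieldType) (a b c x y z : R) :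
  0 <= a -> 0 <= b -> 0 <= c -> a + b + c = 1 -> 0 < x -> 0 < y -> 0 < z ->
  0 < a * x + b * y + c * z.
Proof.
move=> a0 b0 c0 abc x0 y0 z0; pose m := Num.min x (Num.min y z).
have m0 : 0 < m by rewrite !lt_min x0 y0.
have [mx my mz] : [/\ m <= x, m <= y & m <= z] by rewrite !ge_min !lexx !orbT.
rewrite (lt_le_trans m0)// -[m]mul1r -abc !mulrDl.
by rewrite !lerD// ler_wpM2l.
Qed.

(** * Consistent triangles *)

Section Consistent.
Context {R : realType}.
Variables (F : 'rV[R]_2 -> R) (c0 : R) (o0 o1 o2 : 'rV[R]_2).
Hypothesis F_smooth : smooth F.
Hypothesis gamma_compact : compact (zero_set F).
Hypothesis gamma_regular : forall x, zero_set F x -> grad F x != 0.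
Hypothesis c0_gt0 : 0 < c0.
Hypothesis T_consistent : consistent F c0 o0 o1 o2.
Local Notation T := (triangle o0 o1 o2).

Lemma vertex_triangle o : o \in [:: o0; o1; o2] -> T o.
Proof.
rewrite !inE => /or3P[] /eqP->; [exact: vertex0|exact: vertex1|exact: vertex2].
Qed.

Lemma vertex_neq0 o : o \in [:: o0; o1; o2] -> F o != 0.
Proof.
move=> oT; apply/eqP => Fo; have [_ _ /(_ o oT)] := T_consistent.
rewrite gt_max => /andP[+ _]; apply/negP; rewrite -leNgt.
rewrite (le_trans (dist_le _ (Fo : zero_set F o)))// subrr enorm0.
rewrite mulr_ge0 ?(ltW c0_gt0)//.
have T0 := vertex0 o0 o1 o2.
exact: le_trans (enorm_ge0 _) (triangle_le_diam T0 T0).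
Qed.

(** The negative case is the positive one for [- F], which has the same zero set
    and the opposite unit normal. *)
Lemma vertex_side p o : T p -> zero_set F p -> o \in [:: o0; o1; o2] ->
  (0 < F o -> 0 < dot (o - p) (grad F p)) /\
  (F o < 0 -> dot (o - p) (grad F p) < 0).
Proof.
move=> Tp Fp oT; have [reach_gt hK /(_ o oT)] := T_consistent.
rewrite gt_max => /andP[_ far].
have [_ [r [r0 r_reach] <-]] := ereal_sup_gt reach_gt; rewrite lte_fin => hr.
have wh : enorm (o - p) <= diam T := triangle_le_diam (vertex_triangle oT) Tp.
have curv_le := curvature_bounded F_smooth gamma_compact gamma_regular.
have K0 : 0 <= max_curvature F := le_trans (normr_ge0 _) (curv_le p Fp).
have dF x : differentiable F x := F_smooth [::] x.
have turning q0 e : zero_set F q0 -> 0 < e ->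
    exists2 d, 0 < d & forall q, zero_set F q -> enorm (q - q0) < d ->
    `|dot (q - q0) (unit_normal F q0)| <= e * enorm (q - q0) /\
    enorm (unit_normal F q - unit_normal F q0)
      <= (max_curvature F + e) * enorm (q - q0).
  move=> Fq0 e0.
  have [d d0 turn] := normal_turning F_smooth Fq0 (gamma_regular Fq0) e0.
  exists d => // q Fq qd; have [qn nn] := turn q Fq qd; split => //.
  by rewrite (le_trans nn)// ler_wpM2r ?enorm_ge0// lerD2r curv_le.
have positive G : (forall x, differentiable G x) -> zero_set G = zero_set F ->
    (forall x, zero_set G x -> grad G x != 0) ->
    (forall q0 e, zero_set G q0 -> 0 < e ->
      exists2 d, 0 < d & forall q, zero_set G q -> enorm (q - q0) < d ->
      `|dot (q - q0) (unit_normal G q0)| <= e * enorm (q - q0) /\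
      enorm (unit_normal G q - unit_normal G q0)
        <= (max_curvature F + e) * enorm (q - q0)) ->
    0 < G o -> 0 < dot (o - p) (grad G p).
  move=> dG ZG rG turnG Go.
  have compactG := gamma_compact; rewrite -ZG in compactG r_reach Fp far.
  exact: (far_point_side dG compactG rG r_reach K0 turnG hr hK).
split=> Fo; first exact: (positive F).
have ZN := zero_setN F.
have regularN x : zero_set (fun y => - F y) x -> grad (fun y => - F y) x != 0.
  by rewrite ZN => Fx; rewrite gradN// oppr_eq0 gamma_regular.
have := positive (fun y => - F y) (fun y => differentiableN (dF y)) ZN regularN.
rewrite (gradN (dF p)) dotNr !oppr_gt0; apply=> // q0 e; rewrite ZN => Fq0 e0.
have [d d0 turn] := turning q0 e Fq0 e0.
exists d; first exact: d0.
move=> q Fq qd; have [qn nn] := turn q Fq qd.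
rewrite (unit_normalN (dF q)) (unit_normalN (dF q0)).
by rewrite dotNr normrN -opprD enormN.
Qed.

End Consistent.

Unset Implicit Arguments.

Theorem theorem2p2 (R : realType) (F : 'rV[R]_2 -> R)
    (F_smooth : smooth F)
    (gamma_compact : compact (zero_set F))
    (gamma_regular : forall x, zero_set F x -> grad F x != 0)
    (c0 : R) (c0_gt0 : 0 < c0)
    (o0 o1 o2 : 'rV[R]_2)
    (T_nondegenerate : triangle_nondegenerate o0 o1 o2)
    (T_consistent : consistent F c0 o0 o1 o2) :
  let gamma := zero_set F in
  let T := triangle o0 o1 o2 in
  (Num.sg (F o0) = Num.sg (F o1) /\ Num.sg (F o1) = Num.sg (F o2) ->
     gamma `&` T = set0) /\
  (- Num.sg (F o0) = Num.sg (F o1) /\ Num.sg (F o1) = Num.sg (F o2) ->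
     exists phi : 'rV[R]_2 -> 'rV[R]_2,
       (forall p, (T `&` gamma) p -> ray o0 p `&` segment o1 o2 = [set phi p]) /\
       set_bij (T `&` gamma) (segment o1 o2) phi).
Proof.
move=> gamma T.
have side p o := vertex_side F_smooth gamma_compact gamma_regular T_consistent
  (p := p) (o := o).
have [v0 v1 v2] : [/\ o0 \in [:: o0; o1; o2], o1 \in [:: o0; o1; o2]
    & o2 \in [:: o0; o1; o2]].
  by rewrite !inE !eqxx !orbT.
have dF x : differentiable F x := F_smooth [::] x.
have F1 := vertex_neq0 c0_gt0 T_consistent v1.
have sg_gt0 o : (Num.sg (F o) == 1) = (0 < F o) by rewrite sgr_cp0.
have sg_lt0 o : (Num.sg (F o) == -1) = (F o < 0) by rewrite sgr_cp0.
split=> -[s01 s12].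
  apply/seteqP; split=> // p [Fp Tp].
  have [a [b [c [a0 b0 c0' abc pE]]]] := Tp.
  have := dot_barycentric (grad F p) abc pE.
  have [pos0 neg0] := side p o0 Tp Fp v0.
  have [pos1 neg1] := side p o1 Tp Fp v1.
  have [pos2 neg2] := side p o2 Tp Fp v2.
  have [F1_lt0|F1_gt0|//] := ltgtP (F o1) 0; last by move: F1 => /eqP.
    have F0_lt0 : F o0 < 0 by rewrite -sg_lt0 s01 sg_lt0.
    have F2_lt0 : F o2 < 0 by rewrite -sg_lt0 -s12 sg_lt0.
    move=> /(congr1 -%R); rewrite oppr0 !opprD -!mulrN => /eqP.
    by rewrite gt_eqF// convex_comb_gt0 ?oppr_gt0 ?neg0 ?neg1 ?neg2.
  have F0_gt0 : 0 < F o0 by rewrite -sg_gt0 s01 sg_gt0.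
  have F2_gt0 : 0 < F o2 by rewrite -sg_gt0 -s12 sg_gt0.
  by move=> /eqP; rewrite gt_eqF// convex_comb_gt0 ?pos0 ?pos1 ?pos2.
have [F1_lt0|F1_gt0|F1_eq0] := ltgtP (F o1) 0; last by rewrite F1_eq0 eqxx in F1.
- have F0_gt0 : 0 < F o0 by rewrite -sg_gt0 -eqr_opp s01 sg_lt0.
  have F2_lt0 : F o2 < 0 by rewrite -sg_lt0 -s12 sg_lt0.
  have := @central_projection_bij R o0 o1 o2 (fun x => - F x) T_nondegenerate.
  rewrite zero_setN oppr_lt0 oppr_gt0; apply => //.
    by move=> x; exact: differentiableN.
  move=> p Tp /eqP; rewrite oppr_eq0 => /eqP Fp.
  have [pos0 _] := side p o0 Tp Fp v0.
  have [_ neg1] := side p o1 Tp Fp v1.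
  have [_ neg2] := side p o2 Tp Fp v2.
  by rewrite gradN// !dotNr oppr_lt0 !oppr_gt0 pos0 ?neg1 ?neg2.
have F0_lt0 : F o0 < 0 by rewrite -sg_lt0 -eqr_opp s01 opprK sg_gt0.
have F2_gt0 : 0 < F o2 by rewrite -sg_gt0 -s12 sg_gt0.
apply: central_projection_bij => // p Tp Fp.
have [_ neg0] := side p o0 Tp Fp v0.
have [pos1 _] := side p o1 Tp Fp v1.
have [pos2 _] := side p o2 Tp Fp v2.
by rewrite neg0 ?pos1 ?pos2.
Qed.
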